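(* The poset of biclosed subsets of the positive roots of $A_\infty$, ordered by containment, is a complete lattice.
   Context: $A_\infty$ is the group of permutations of $\mathbb{Z}$ fixing all but finitely many points, with simple generators $(i,i+1)$. Its positive roots are $\Phi^+=\{\beta_{ij}=e_j-e_i:i<j\}$ in the real vector space with basis $e_i$, $i\in\mathbb{Z}$. A subset $B\subseteq\Phi^+$ is biclosed if for all $\alpha,\beta,\gamma\in\Phi^+$ with $\gamma\in\mathbb{R}_{>0}\alpha+\mathbb{R}_{>0}\beta$: $\alpha,\beta\in B\Rightarrow\gamma\in B$, and $\alpha,\beta\notin B\Rightarrow\gamma\notin B$. *)

(* Defs.v *)
From HB Require Import structures.
From mathcomp Require Import all_boot all_order all_algebra.
From mathcomp Require Import boolp classical_sets reals.
From mathcomp Require Import monalg.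
Set Implicit Arguments.
Unset Strict Implicit.
Unset Printing Implicit Defensive.
Import Order.TTheory GRing.Theory Num.Theory.
Local Open Scope classical_set_scope.
Local Open Scope ring_scope.

Section RootsAinfty.
Variable R : realType.

(* [{malg R[int]}] is the free R-module on int, with basis [<< i >>]; its
   convolution product is not used. *)
Definition root_space : lmodType R := {malg R[int]}.

Definition basis_vec (i : int) : root_space := << i >>.

Definition beta (i j : int) : root_space := basis_vec j - basis_vec i.

Definition positive_roots : set root_space :=
  [set v | exists i j : int, i < j /\ v = beta i j].

Definition pos_combination (a b c : root_space) : Prop :=
  exists s t : R, [/\ 0 < s, 0 < t & c = s *: a + t *: b].

Definition biclosed (B : set root_space) : Prop :=
  B `<=` positive_roots /\
  forall a b c : root_space,
    positive_roots a -> positive_roots b -> positive_roots c ->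
    pos_combination a b c ->
    (B a -> B b -> B c) /\ (~ B a -> ~ B b -> ~ B c).

Record biclosed_set : Type := BiclosedSet {
  biclosed_val :> set root_space;
  biclosed_valP : `[< biclosed biclosed_val >]
}.

HB.instance Definition _ := [isSub for biclosed_val].
HB.instance Definition _ := [Choice of biclosed_set by <:].
(* The order induced from [set root_space], i.e. containment; see
   [biclosed_leE]. *)
HB.instance Definition _ := [SubChoice_isSubPOrder of biclosed_set by <:
  with set_display].

Lemma biclosed_leE (B C : biclosed_set) : (B <= C)%O = `[< B `<=` C >].
Proof. by rewrite -Order.le_val; apply/idP/asboolP => /subsetPset. Qed.

End RootsAinfty.

Definition complete_lattice (d : Order.disp_t) (L : porderType d) : Prop :=
  forall S : set L, supremums S !=set0 /\ infimums S !=set0.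

(* Main.v *)
(** A positive combination of two positive roots which is a positive root is
    either one of the two roots or the sum of two composable roots
    [beta i j + beta j k].  Hence a biclosed set is a transitive subrelation of
    [<] on the integers whose complement in [<] is also transitive.  The
    transitive closure of a union of such relations is again of this form: if
    [j] lies strictly between the ends of a chain, then either [j] is on the
    chain or it splits one of its steps, and that step lies in a single
    biclosed set.  So all suprema exist, and an infimum is the supremum of the
    lower bounds. *)
Require Import Defs.
From HB Require Import structures.
From mathcomp Require Import all_boot all_order all_algebra.
From mathcomp Require Import boolp classical_sets reals.
From mathcomp Require Import monalg lra.
From Stdlib Require Import Relations.
Set Implicit Arguments.
Unset Strict Implicit.
Unset Printing Implicit Defensive.
Import Order.TTheory GRing.Theory Num.Theory.
Local Open Scope classical_set_scope.
Local Open Scope ring_scope.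

Section Biclosed.
Variable R : realType.
Implicit Types (i j k l m n : int) (U B : set (root_space R)).

Lemma beta_combination_coord (s t : R) i j k l m n :
  beta R m n = s *: beta R i j + t *: beta R k l ->
  forall x : int, (x == n)%:R - (x == m)%:R =
    s * ((x == j)%:R - (x == i)%:R) + t * ((x == l)%:R - (x == k)%:R) :> R.
Proof.
move=> e x; have := congr1 (mcoeff x) e.
have mD (u v : root_space R) : mcoeff x (u + v) = mcoeff x u + mcoeff x v.
  exact: mcoeffD.
have mZ (c : R) (v : root_space R) : mcoeff x (c *: v) = c * mcoeff x v.
  exact: mcoeffZ.
have mbeta p q : mcoeff x (beta R p q) = (x == q)%:R - (x == p)%:R.
  by rewrite mcoeffB !mcoeffU !(eq_sym _ x).
by rewrite mbeta mD !mZ !mbeta.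
Qed.

(** Signs decide: as [s] and [t] are positive, the right side can be positive only at coordinates
    [j], [l] and negative only at [i], [k]. *)
Lemma beta_pos_combination i j k l m n : i < j -> k < l -> m < n ->
  pos_combination (beta R i j) (beta R k l) (beta R m n) ->
  [\/ beta R m n = beta R i j, beta R m n = beta R k l,
      [/\ j = k, m = i & n = l] | [/\ l = i, m = k & n = j]].
Proof.
move=> ij kl mn [s [t [s0 t0 /beta_combination_coord e]]].
have hn : n = j \/ n = l.
  apply: contrapT => /not_orP[/eqP nj /eqP nl].
  have := e n; rewrite eqxx (gt_eqF mn) (negbTE nj) (negbTE nl).
  by case: (n == i); case: (n == k) => /=; lra.
have hm : m = i \/ m = k.
  apply: contrapT => /not_orP[/eqP mi /eqP mk].
  have := e m; rewrite eqxx (lt_eqF mn) (negbTE mi) (negbTE mk).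
  by case: (m == j); case: (m == l) => /=; lra.
case: hn hm e => -> [->|->] e; [by constructor 1| | |by constructor 2].
(* Mixed case [beta k j]: if [i] differs from [k] and [l], coordinate [i] reads [0 = - s]. The other
   mixed case is symmetric, with coordinate [k] and [- t]. *)
- have [->|ik] := eqVneq i k; first by constructor 1.
  have [->|li] := eqVneq i l; first by constructor 4.
  have := e i; rewrite eqxx (lt_eqF ij) (negbTE ik) (negbTE li) /=; lra.
- have [->|ik] := eqVneq k i; first by constructor 2.
  have [->|jk] := eqVneq k j; first by constructor 3.
  have := e k; rewrite eqxx (lt_eqF kl) (negbTE ik) (negbTE jk) /=; lra.
Qed.

Lemma pos_combination_beta i j k :
  pos_combination (beta R i j) (beta R j k) (beta R i k).
Proof.
by exists 1, 1; split; rewrite ?ltr01// !scale1r [RHS]addrC /beta addrA subrK.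
Qed.

Lemma biclosed_trans B i j k : biclosed B -> i < j -> j < k ->
  B (beta R i j) -> B (beta R j k) -> B (beta R i k).
Proof.
move=> [_ Bb] ij jk; have ik := lt_trans ij jk.
apply: (proj1 (Bb _ _ _ _ _ _ (pos_combination_beta i j k)));
  by [exists i, j | exists j, k | exists i, k].
Qed.

(** Contrapositive of the closure of the complement. Unlike [biclosed_trans], this form passes to
    unions. *)
Lemma biclosed_split B i j k : biclosed B -> i < j -> j < k ->
  B (beta R i k) -> B (beta R i j) \/ B (beta R j k).
Proof.
move=> [_ Bb] ij jk Bik; have ik := lt_trans ij jk.
apply: contrapT => /not_orP[nij njk].
by apply: (proj2 (Bb _ _ _ _ _ _ (pos_combination_beta i j k))) Bik => //;
  [exists i, j | exists j, k | exists i, k].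
Qed.

(** As [U] may be any set of vectors, the guard [i < j] is what makes chains increase. *)
Definition root_chain U : relation int :=
  clos_trans int (fun i j => i < j /\ U (beta R i j)).

Definition chain_closure U : set (root_space R) :=
  [set v | exists i j, root_chain U i j /\ v = beta R i j].

Lemma root_chain_lt U i j : root_chain U i j -> i < j.
Proof. by elim=> [? ? []//|x y z _ xy _]; exact: lt_trans. Qed.

Lemma root_chain_split U :
  (forall i j k, i < j -> j < k -> U (beta R i k) ->
    U (beta R i j) \/ U (beta R j k)) ->
  forall i j k, i < j -> j < k -> root_chain U i k ->
    root_chain U i j \/ root_chain U j k.
Proof.
move=> Usplit i j k + + ik; elim: ik j => {i k} [i k [_ Uik] j ij jk|].
  by case: (Usplit _ _ _ ij jk Uik) => ?; [left|right]; apply: t_step.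
move=> i m k im IHim mk IHmk j ij jk.
(* Split the half that contains [j]; if the resulting piece ends at the joint [m], the other half
   prolongs it. *)
case: (ltgtP j m) => [jm|mj|->]; last by left.
- by have [|?] := IHim _ ij jm; [left|right; apply: t_trans mk].
- by have [?|] := IHmk _ mj jk; [left; apply: t_trans im _|right].
Qed.

Lemma biclosed_chain_closure U :
  (forall i j k, i < j -> j < k -> U (beta R i k) ->
    U (beta R i j) \/ U (beta R j k)) ->
  biclosed (chain_closure U).
Proof.
move=> Usplit; split=> [_ [i [j [/root_chain_lt ij ->]]]|]; first by exists i, j.
move=> _ _ _ [i [j [ij ->]]] [k [l [kl ->]]] [m [n [mn ->]]] abc; split.
(* Membership supplies its own indices; rewriting [abc] with them avoids an appeal to injectivity of
   [beta]. *)
- move=> [i' [j' [ij' eij]]] [k' [l' [kl' ekl]]]; rewrite eij ekl in abc.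
  have [->|->|[jk -> ->]|[li -> ->]] := beta_pos_combination
    (root_chain_lt ij') (root_chain_lt kl') mn abc.
  + by exists i', j'.
  + by exists k', l'.
  + by exists i', l'; split=> //; apply: t_trans ij' _; rewrite jk.
  + by exists k', j'; split=> //; apply: t_trans kl' _; rewrite li.
- move=> nij nkl [m' [n' [mn' emn]]]; rewrite emn in abc.
  have [e|e|[jk mi nl]|[li mk nj]] := beta_pos_combination
    ij kl (root_chain_lt mn') abc.
  + by apply: nij; exists m', n'.
  + by apply: nkl; exists m', n'.
  + subst k m' n'.
    by have [?|?] := root_chain_split Usplit ij kl mn';
      [apply: nij; exists i, j|apply: nkl; exists j, l].
  + subst l m' n'.
    by have [?|?] := root_chain_split Usplit kl ij mn';
      [apply: nkl; exists k, i|apply: nij; exists i, j].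
Qed.

Lemma chain_closure_sub U B : biclosed B -> U `<=` B -> chain_closure U `<=` B.
Proof.
move=> Bb UB _ [i [j [ij ->]]]; elim: ij => {i j} [i j [_ /UB]//|i j k ij Bij jk Bjk].
exact: (biclosed_trans Bb (root_chain_lt ij) (root_chain_lt jk) Bij Bjk).
Qed.

Lemma biclosed_supremums (S : set (biclosed_set R)) : supremums S !=set0.
Proof.
pose U := \bigcup_(B in S) (B : set (root_space R)).
have valP (B : biclosed_set R) : biclosed B by exact/asboolP/biclosed_valP.
have Ub : biclosed (chain_closure U).
  apply: biclosed_chain_closure => i j k ij jk [B SB].
  by case/(biclosed_split (valP B) ij jk) => ?; [left|right]; exists B.
exists (BiclosedSet (asboolT Ub)); split=> [B SB|C SC].
  rewrite biclosed_leE; apply/asboolP => v Bv.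
  (* Being a positive root, [v] is a chain of one step. *)
  have [i [j [ij vE]]] := (valP B).1 v Bv.
  by exists i, j; split=> //; apply: t_step; split=> //; rewrite -vE; exists B.
rewrite biclosed_leE; apply/asboolP; apply: chain_closure_sub => //.
by move=> v [B /SC]; rewrite biclosed_leE => /asboolP; apply.
Qed.

End Biclosed.

Theorem theorem5p3 (R : realType) : complete_lattice (biclosed_set R).
Proof.
move=> S; split; first exact: biclosed_supremums.
have [x [ubx lbx]] := biclosed_supremums (lbound S).
(* Each [B] in [S] bounds [lbound S] from above, so the least such bound [x] lies below [B]. *)
exists x; split=> [B SB|y lby]; last exact: ubx.
by apply: lbx => y lby; exact: lby.
Qed.
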